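(* Let $n\geq 2$. For every $\alpha\in(1/n,1)$ there exist a bounded convex domain $\Omega\subset\mathbb R^n$ and a convex function $v\in C(\overline{\Omega})\cap C^\infty(\Omega)$ with $v=0$ on $\partial\Omega$ and $\det D^2 v\in L^1(\Omega)$, but $v\notin C^{\alpha}(\overline{\Omega})$. *)

(* Defs.v *)
From HB Require Import structures.
From mathcomp Require Import all_boot all_order all_algebra.
From mathcomp Require Import all_classical all_reals all_analysis.

Set Implicit Arguments.
Unset Strict Implicit.
Unset Printing Implicit Defensive.

Import Order.TTheory GRing.Theory Num.Theory.
Import numFieldNormedType.Exports.

Local Open Scope classical_set_scope.
Local Open Scope ring_scope.

Section Defs.
Variable R : realType.

Definition eucl_norm n (x : 'rV[R]_n) : R := Num.sqrt (\sum_(i < n) x ord0 i ^+ 2).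

Definition e_vec n (i : 'I_n) : 'rV[R]_n := delta_mx ord0 i.

Definition partial n (i : 'I_n) (f : 'rV[R]_n -> R) : 'rV[R]_n -> R :=
  fun x => 'D_(e_vec i) f x.

Fixpoint Ck n (k : nat) (U : set 'rV[R]_n) (f : 'rV[R]_n -> R) : Prop :=
  match k with
  | 0 => forall x, U x -> {for x, continuous f}
  | k'.+1 => (forall x, U x -> differentiable f x) /\
             (forall i : 'I_n, Ck k' U (partial i f))
  end.

Definition smooth_on n (U : set 'rV[R]_n) (f : 'rV[R]_n -> R) : Prop :=
  forall k, Ck k U f.

Definition hessian n (f : 'rV[R]_n -> R) (x : 'rV[R]_n) : 'M[R]_n :=
  \matrix_(i < n, j < n) partial i (partial j f) x.

Definition convex_set_Rn n (A : set 'rV[R]_n) : Prop :=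
  forall x y (t : R), A x -> A y -> 0 <= t -> t <= 1 ->
    A ((1 - t) *: x + t *: y).

Definition convex_fun_on n (A : set 'rV[R]_n) (f : 'rV[R]_n -> R) : Prop :=
  forall x y (t : R), A x -> A y -> 0 <= t -> t <= 1 ->
    f ((1 - t) *: x + t *: y) <= (1 - t) * f x + t * f y.

(* Lebesgue integral over R^n of a function with values in \bar R, defined
   as the iterated one-dimensional Lebesgue integral (Tonelli); used only
   for nonnegative integrands. *)
Fixpoint iter_integral n : ('rV[R]_n -> \bar R) -> \bar R :=
  match n with
  | 0 => fun f => f 0
  | n'.+1 => fun f =>
      (\int[@lebesgue_measure R]_(t in [set: R])
          iter_integral (fun y : 'rV[R]_n' => f (row_mx (t%:M : 'rV[R]_1) y)))%E
  end.

(* f restricted to U is in L^1(U): \int_U |f| dx < +oo (n-dim Lebesgue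
   integral written as iterated 1-d integrals).  Measurability is not
   required separately: in the theorem the integrand is continuous on the
   open set U, hence automatically measurable. *)
Definition L1_on n (U : set 'rV[R]_n) (f : 'rV[R]_n -> R) : Prop :=
  (iter_integral (fun x => if `[< U x >] then (`|f x|)%:E else 0%E) < +oo)%E.

Definition holder_on n (alpha : R) (A : set 'rV[R]_n) (f : 'rV[R]_n -> R) : Prop :=
  exists C : R, forall x y, A x -> A y ->
    `|f x - f y| <= C * (eucl_norm (x - y)) `^ alpha.

End Defs.

(* Main.v *)
(* Write y for the last coordinate and H = 1 - |x'|^2 for a function of the
   others, and let Omega = {0 < y < H}, v = y - y^b H^(1-b) with 1/n < b < alpha.
   The weighted geometric mean y^b H^(1-b) is concave because y and H are, and it
   equals y both where y = 0 and where y = H, so v is convex and vanishes on the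
   boundary.  The map (y, H) |-> y^b H^(1-b) is homogeneous of degree one, so its
   Hessian has rank one; hence D^2 v is a multiple of the identity in x' plus a
   rank-one matrix, and det D^2 v = C y^(nb-2) H^(1-nb).  Integrating in y over
   (0, H) gives the constant C/(nb-1), so the determinant is integrable exactly
   because b > 1/n, while v(0, y) = y - y^b is not alpha-Hoelder at y = 0. *)
Require Import Defs.
From HB Require Import structures.
From mathcomp Require Import all_boot all_order all_algebra.
From mathcomp Require Import all_classical all_reals all_analysis.
From mathcomp Require Import measurable_realfun.
From mathcomp Require Import ring lra.
Import Order.TTheory GRing.Theory Num.Theory.
Import numFieldNormedType.Exports.
Local Open Scope classical_set_scope.
Local Open Scope ring_scope.

(** * One-dimensional integrals of powers *)

(* Unlike [ge0_le_integral], this needs no measurability. *)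
Lemma ge0_le_integralT (R : realType) (f g : R -> \bar R) :
  (forall x, (0 <= f x)%E) -> (forall x, (f x <= g x)%E) ->
  (\int[lebesgue_measure]_x f x <= \int[lebesgue_measure]_x g x)%E.
Proof.
move=> f0 fg; have g0 x : (0 <= g x)%E by exact: le_trans (fg x).
rewrite !ge0_integralTE//; apply: ereal_sup_le => _ [h hf <-].
by exists h => // x; exact: le_trans (fg x).
Qed.

Lemma gt0_powR_continuous (R : realType) (q t : R) : 0 < t ->
  {for t, continuous (@powR R ^~ q)}.
Proof.
move=> t0; apply/differentiable_continuous/derivable1_diffP.
by apply: derivable_powR; rewrite in_itv/= t0.
Qed.

(** The integrand may blow up at 0, so the fundamental theorem is applied on intervals ending at [h]
    that stay away from 0, and monotone convergence exhausts []0, h]]. Dropping the nonnegative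
    value of the antiderivative at the left end gives the bound. *)
Lemma integral_powR_le (R : realType) (p h : R) : 0 < p -> 0 < h ->
  (\int[lebesgue_measure]_(t in `]0%R, h]) (t `^ (p - 1))%:E
     <= (h `^ p / p)%:E)%E.
Proof.
move=> p0 h0.
(* [k.+2] keeps the left end strictly below [h] already at [k = 0], as [continuous_FTC2]
   requires. *)
pose F (k : nat) : set R := `[h / k.+2%:R, h]%classic.
have FE : \bigcup_k F k = `]0, h]%classic.
  apply/seteqP; split => [x [k _]|x]; rewrite /F /= !in_itv/=.
    by move=> /andP[xk xh]; rewrite xh andbT (lt_le_trans _ xk)// divr_gt0.
  move=> /andP[x0 xh]; have := archi_boundP (ltW (divr_gt0 h0 x0)).
  set k := Num.bound _ => kP; exists k => //=; rewrite in_itv/= xh andbT.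
  rewrite ler_pdivrMr// mulrC -ler_pdivrMr// (le_trans (ltW kP))// ler_nat.
  by rewrite -addn2 leq_addr.
have mf (A : set R) : measurable_fun A (EFin \o (@powR R ^~ (p - 1))).
  apply: (@measurable_funS _ _ _ _ setT) => //.
  by apply/measurable_EFinP; exact: measurable_powR.
rewrite -FE.
have cv : (\int[lebesgue_measure]_(x in F i) (x `^ (p - 1))%:E @[i --> \oo] -->
   \int[lebesgue_measure]_(x in \bigcup_i F i) (x `^ (p - 1))%:E)%E.
  apply: ge0_nondecreasing_set_cvg_integral => //.
  - move=> i j ij; apply/subsetPset => x; rewrite /F /= !in_itv/= => /andP[xi xh].
    rewrite xh andbT (le_trans _ xi)// ler_pM2l// lef_pV2 ?posrE//.
    by rewrite ler_nat !ltnS.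
  - by move=> i; exact: measurable_itv.
  - by move=> i; exact: mf.
  - by move=> i x _; rewrite lee_fin powR_ge0.
apply: (cvge_to_le cv); apply: nearW => k.
have ak : 0 < h / k.+2%:R by rewrite divr_gt0.
have akh : h / k.+2%:R < h by rewrite ltr_pdivrMr// ltr_pMr// ltr1n.
have dF (t : R) : 0 < t -> is_derive t 1 (fun t : R => t `^ p / p) (t `^ (p - 1)).
  move=> t0; have -> : (fun t : R => t `^ p / p) = (p^-1 *: (@powR R ^~ p)).
    by apply/funext => x; rewrite /= mulrC.
  have := @is_derive1_powR _ p t t0 => dd.
  by apply: is_derive_eq; rewrite scalerA mulVf ?gt_eqF// scale1r.
have cF (t : R) : 0 < t -> {for t, continuous (fun t : R => t `^ p / p)}.
  by move=> t0; apply/differentiable_continuous/derivable1_diffP; case: (dF t t0).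
rewrite (@continuous_FTC2 _ _ (fun t => t `^ p / p))//.
- by rewrite -EFinB lee_fin gerBl divr_ge0 ?powR_ge0// ltW.
- apply: continuous_in_subspaceT => x; rewrite inE/= in_itv/= => /andP[ax _].
  by apply: gt0_powR_continuous; exact: lt_le_trans ax.
- split.
  + by move=> x; rewrite in_itv/= => /andP[ax _]; case: (dF x (lt_trans ak ax)).
  + by apply: cvg_at_right_filter; exact: cF.
  + by apply: cvg_at_left_filter; exact: cF.
- move=> x; rewrite in_itv/= => /andP[ax _]; rewrite derive1E.
  by case: (dF x (lt_trans ak ax)).
Qed.

(** * Bounds on iterated integrals *)

Lemma iter_integralS (R : realType) n (f : 'rV[R]_n.+1 -> \bar R) :
  iter_integral f = (\int[lebesgue_measure]_t
    iter_integral (fun y : 'rV[R]_n => f (row_mx (t%:M : 'rV[R]_1) y)))%E.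
Proof. by []. Qed.

Lemma iter_integral_ge0 (R : realType) n (f : 'rV[R]_n -> \bar R) :
  (forall x, (0 <= f x)%E) -> (0 <= iter_integral f)%E.
Proof.
elim: n f => [|n IH] f f0 /=; first exact: f0.
by apply: integral_ge0 => t _; apply: IH => y; exact: f0.
Qed.

Lemma iter_integral_eq0 (R : realType) n (f : 'rV[R]_n -> \bar R) :
  (forall x, f x = 0%E) -> iter_integral f = 0%E.
Proof.
elim: n f => [|n IH] f f0 /=; first exact: f0.
by apply: integral0_eq => t _; apply: IH => y; exact: f0.
Qed.

Definition set_last {R : realType} {m} (x : 'rV[R]_m.+1) (t : R) : 'rV[R]_m.+1 :=
  \row_i (if i == ord_max then t else x ord0 i).

(** Lets the induction in [iter_integral_le] carry its bound on integrals over the last coordinate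
    to the slices at a fixed first coordinate. *)
Lemma set_last_row_mx (R : realType) m (t s : R) (y : 'rV[R]_m.+1) :
  row_mx (t%:M : 'rV[R]_1) (set_last y s) =
  set_last (row_mx (t%:M : 'rV[R]_1) y : 'rV[R]_m.+2) s.
Proof.
apply/rowP => i; rewrite [RHS]mxE.
case: (split_ordP (i : 'I_(1 + m.+1))) => j ->.
  rewrite row_mxEl (row_mxEl (t%:M : 'rV_1) y) ifF//.
  by rewrite ord1; apply/negP => /eqP /(congr1 val).
rewrite row_mxEr mxE (row_mxEr (t%:M : 'rV_1) y); by congr (if _ then _ else _).
Qed.

(* The last coordinate is the innermost variable of [iter_integral]. *)
Lemma iter_integral_le (R : realType) m (f : 'rV[R]_m.+1 -> \bar R) (K : R) :
  (forall x, (0 <= f x)%E) ->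
  (forall (x : 'rV[R]_m.+1) (i : 'I_m.+1), i != ord_max -> 1 < `|x ord0 i| -> f x = 0%E) ->
  (forall x, (\int[lebesgue_measure]_t f (set_last x t) <= K%:E)%E) ->
  (iter_integral f <= (K * 2 ^+ m)%:E)%E.
Proof.
elim: m f => [|m IH] f f0 fout fK.
  rewrite expr0 mulr1; apply: le_trans (fK 0); rewrite iter_integralS/=.
  apply: ge0_le_integralT => [t|t]; first exact: f0.
  suff -> : row_mx (t%:M : 'rV_1) (0 : 'rV[R]_0) = set_last (0 : 'rV[R]_1) t by [].
  apply/rowP => i; rewrite [RHS]mxE ifT; last by rewrite ord1; apply/eqP/val_inj.
  have -> : i = lshift 0 (ord0 : 'I_1) by rewrite [LHS]ord1; exact/val_inj.
  by rewrite row_mxEl mxE.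
rewrite iter_integralS.
set c := K * 2 ^+ m.
have K0 : 0 <= K.
  by rewrite -lee_fin; apply: le_trans (fK 0); apply: integral_ge0 => t _; exact: f0.
have c0 : 0 <= c by rewrite mulr_ge0// exprn_ge0.
(* Slices vanish for [t] outside [-1, 1] and are at most [c] inside, so each outer variable costs a
   factor 2. *)
apply: (@le_trans _ _
  (\int[lebesgue_measure]_t (((fun=> c%:E) \_ `[(-1)%R, 1%R]) t)))%E.
  apply: ge0_le_integralT => [t|t]; first by apply: iter_integral_ge0.
  rewrite patchE; case: ifPn => [_|].
    apply: IH => [y|y i im yi|y]; first exact: f0.
      apply: (fout _ (rshift 1 i)); last by rewrite (row_mxEr (t%:M : 'rV_1) y).
      apply: contra im => /eqP /(congr1 val) /= [] im.
      by apply/eqP/val_inj.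
    by under eq_integral do rewrite set_last_row_mx; exact: fK.
  move=> t1; rewrite iter_integral_eq0// => y.
  apply: (fout _ (lshift m.+1 (ord0 : 'I_1))); first by [].
  rewrite (row_mxEl (t%:M : 'rV_1) y) mxE eqxx mulr1n ltNge; apply: contra t1.
  by rewrite ler_norml inE/= in_itv/=.
rewrite -integral_mkcond integral_cst//= lebesgue_measure_itv/= lte_fin.
rewrite ifT; last by lra.
by rewrite -EFinD -EFinM lee_fin /c exprSr; lra.
Qed.

(** * Symbolic differentiation and smoothness *)

(** The first-order expansion of [f] at [a] is also one of [g], and uniqueness of the differential
    makes its linear part the differential of [g]. *)
Lemma near_eq_differentiable (R : realType) (V W : normedModType R)
    (f g : V -> W) (a : V) :
  (\near a, f a = g a) -> differentiable f a -> differentiable g a.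
Proof.
move=> fg /diff_locallyP[cf ef]; have fga := nbhs_singleton fg.
have eg : g \o shift a = cst (g a) + 'd f a +o_0 id.
  apply/eqaddoP => e e0; move/eqaddoP : ef => /(_ e e0) ef.
  have fg0 : \forall h \near (0 : V), f (h + a) = g (h + a).
    by move: fg; rewrite (near_shift 0 a); apply: filterS => h /=; rewrite subr0.
  near=> h; have : f (h + a) = g (h + a) by near: h.
  have : `|(f \o shift a - (cst (f a) + 'd f a)) h| <= e * `|id h| by near: h.
  by rewrite /= !fctE /= fga => + <-.
have dg := diff_unique cf eg.
by apply/diff_locallyP; rewrite dg.
Unshelve. all: by end_near. Qed.

(* A syntactic class of functions closed under partial derivatives: smoothness
   then follows by induction on the order. *)
Inductive sexpr (R : realType) (n : nat) : Type :=
| ECst of R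
| EVar of 'I_n
| EAdd of sexpr R n & sexpr R n
| EMul of sexpr R n & sexpr R n
| EPow of sexpr R n & R.
Arguments ECst {R n}.
Arguments EVar {R n}.
Arguments EAdd {R n}.
Arguments EMul {R n}.
Arguments EPow {R n}.

Fixpoint seval {R : realType} {n} (e : sexpr R n) (x : 'rV[R]_n) : R :=
  match e with
  | ECst c => c
  | EVar i => x ord0 i
  | EAdd e1 e2 => seval e1 x + seval e2 x
  | EMul e1 e2 => seval e1 x * seval e2 x
  | EPow e1 a => seval e1 x `^ a
  end.

Fixpoint sderiv {R : realType} {n} (i : 'I_n) (e : sexpr R n) : sexpr R n :=
  match e with
  | ECst c => ECst 0
  | EVar j => ECst (j == i)%:R
  | EAdd e1 e2 => EAdd (sderiv i e1) (sderiv i e2)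
  | EMul e1 e2 => EAdd (EMul e1 (sderiv i e2)) (EMul e2 (sderiv i e1))
  | EPow e1 a => EMul (EMul (ECst a) (EPow e1 (a - 1))) (sderiv i e1)
  end.

(* Bases of real powers are positive at [x]; [powR] has the junk value [1] at
   negative bases and is not differentiable at [0]. *)
Fixpoint sdefined {R : realType} {n} (e : sexpr R n) (x : 'rV[R]_n) : Prop :=
  match e with
  | EAdd e1 e2 | EMul e1 e2 => sdefined e1 x /\ sdefined e2 x
  | EPow e1 a => 0 < seval e1 x /\ sdefined e1 x
  | _ => True
  end.

(** Differentiating a power shifts its exponent but keeps its base, so no new positivity condition
    arises. *)
Lemma sdefined_sderiv (R : realType) n (i : 'I_n) (e : sexpr R n) x :
  sdefined e x -> sdefined (sderiv i e) x.
Proof.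
by elim: e => //= [e1 IH1 e2 IH2|e1 IH1 e2 IH2|e1 IH1 a] [] d1 d2;
  split; auto.
Qed.

Lemma seval_differentiable (R : realType) n (e : sexpr R n) (x : 'rV[R]_n) :
  sdefined e x -> differentiable (seval e) x /\
    forall i, partial i (seval e) x = seval (sderiv i e) x.
Proof.
elim: e => [c|j|e1 IH1 e2 IH2|e1 IH1 e2 IH2|e1 IH1 a] /=.
- move=> _; split; first exact: differentiable_cst.
  by move=> i; rewrite /partial derive_cst.
- move=> _; split; first exact: differentiable_coord.
  move=> i; rewrite /partial.
  have -> : (fun x : 'rV[R]_n => x ord0 j) = seval (EVar j) by [].
  (* For nonzero [h] the difference quotient of a coordinate along a basis vector is exactly
     [(j == i)%:R]. *)
  rewrite /derive; apply: cvg_lim => //.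
  apply: (@cvg_trans _ ((fun=> (j == i)%:R : R) @ (0 : R)^')); last exact: cvg_cst.
  apply: near_eq_cvg; near=> h => /=; rewrite !mxE/= addrK.
  rewrite -[RHS]/(h^-1 * _) mulKf//.
  by near: h; exact: nbhs_dnbhs_neq.
- move=> [/IH1[d1 p1] /IH2[d2 p2]].
  have -> : (fun x => seval e1 x + seval e2 x) = seval e1 + seval e2 by [].
  split; first exact: differentiableD.
  by move=> i; rewrite -p1 -p2 /partial deriveD//; exact: diff_derivable.
- move=> [/IH1[d1 p1] /IH2[d2 p2]].
  have -> : (fun x => seval e1 x * seval e2 x) = seval e1 * seval e2 by [].
  split; first exact: differentiableM.
  by move=> i; rewrite -p1 -p2 /partial deriveM//; exact: diff_derivable.
- move=> [e1x /IH1[d1 p1]].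
  have -> : (fun x => seval e1 x `^ a) = (@powR R ^~ a) \o seval e1 by [].
  have dp : differentiable (@powR R ^~ a) (seval e1 x).
    by apply/derivable1_diffP; apply: derivable_powR; rewrite in_itv/= e1x.
  have dc := differentiable_comp d1 dp.
  split=> // i; rewrite /partial deriveE// diff_comp//= diff1E//=.
  rewrite -deriveE// powR_derive1 ?in_itv/= ?e1x// -p1.
  by rewrite [LHS]mulrC.
Unshelve. all: by end_near. Qed.

(** Agreement on an open set passes to the partial derivatives, so the lemma applies again to
    [partial i f] and [sderiv i e]. *)
Lemma seval_near_partial (R : realType) n (U : set 'rV[R]_n) (e : sexpr R n)
    (f : 'rV[R]_n -> R) :
  open U -> (forall x, U x -> sdefined e x) ->
  (forall x, U x -> f x = seval e x) ->
  forall x, U x -> differentiable f x /\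
    forall i, partial i f x = seval (sderiv i e) x.
Proof.
move=> oU de fe x Ux; have [d p] := seval_differentiable _ _ _ _ (de _ Ux).
have ef : \near x, f x = seval e x.
  by near=> z; apply: fe; near: z; exact: open_nbhs_nbhs.
split; first by apply: near_eq_differentiable d; apply: filterS ef => z ->.
by move=> i; rewrite -p /partial; exact: near_eq_derive.
Unshelve. all: by end_near. Qed.

Lemma seval_smooth (R : realType) n (U : set 'rV[R]_n) (e : sexpr R n)
    (f : 'rV[R]_n -> R) :
  open U -> (forall x, U x -> sdefined e x) ->
  (forall x, U x -> f x = seval e x) -> smooth_on U f.
Proof.
move=> oU de fe k; elim: k e f de fe => [|k IH] e f de fe /=.
  move=> x Ux; apply: differentiable_continuous.
  by have [] := seval_near_partial _ _ _ _ _ oU de fe x Ux.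
split=> [x Ux|i]; first by have [] := seval_near_partial _ _ _ _ _ oU de fe x Ux.
apply: (IH (sderiv i e)) => x Ux; first exact/sdefined_sderiv/de.
by have [_ ->] := seval_near_partial _ _ _ _ _ oU de fe x Ux.
Qed.

Lemma seval_hessian (R : realType) n (U : set 'rV[R]_n) (e : sexpr R n)
    (f : 'rV[R]_n -> R) :
  open U -> (forall x, U x -> sdefined e x) ->
  (forall x, U x -> f x = seval e x) ->
  forall x, U x ->
    hessian f x = \matrix_(i, j) seval (sderiv i (sderiv j e)) x.
Proof.
move=> oU de fe x Ux; apply/matrixP => i j; rewrite !mxE.
have dj y : U y -> sdefined (sderiv j e) y by move=> Uy; exact/sdefined_sderiv/de.
have fj y : U y -> partial j f y = seval (sderiv j e) y.
  by move=> Uy; have [_ ->] := seval_near_partial _ _ _ _ _ oU de fe y Uy.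
by have [_ ->] := seval_near_partial _ _ _ _ _ oU dj fj x Ux.
Qed.

(** * Determinant of a diagonal plus rank-one matrix *)

(* The matrix is [P^T D P] with [D] diagonal and [P] the identity matrix whose
   last row is replaced by [w / w ord_max]. *)
Lemma det_diag_rank1 (F : fieldType) m (c k : F) (w : 'I_m.+1 -> F) :
  w ord_max != 0 ->
  \det (\matrix_(i, j) ((if (i == j) && (i != ord_max) then c else 0)
                        + k * w i * w j) : 'M[F]_m.+1)
  = c ^+ m * (k * w ord_max ^+ 2).
Proof.
move=> w0.
pose P : 'M[F]_m.+1 :=
  \matrix_(i, j) if i == ord_max then w j / w ord_max else (i == j)%:R.
pose d : 'rV[F]_m.+1 := \row_i if i == ord_max then k * w ord_max ^+ 2 else c.
have -> : \matrix_(i, j) ((if (i == j) && (i != ord_max) then c else 0)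
                        + k * w i * w j) = P^T *m diag_mx d *m P.
  apply/matrixP => i j; rewrite [LHS]mxE mul_mx_diag mxE.
  rewrite (bigD1 ord_max)//= addrC; congr (_ + _); last first.
    by rewrite !mxE eqxx; field.
  have [->|im] := eqVneq i ord_max.
    by rewrite andbF big1// => l lm; rewrite !mxE (negbTE lm) mul0r mul0r.
  rewrite /= andbT (bigD1 i)//= big1 ?addr0 => [|l /andP[lm li]].
    by rewrite !mxE (negbTE im) eqxx mul1r; case: eqP; rewrite ?mulr1 ?mulr0.
  by rewrite !mxE (negbTE lm) (negbTE li) !mul0r.
rewrite !det_mulmx det_tr det_diag.
(* Only the last row of [P] departs from the identity, so [P] is lower triangular with unit
   diagonal. *)
have -> : \det P = 1.
  rewrite det_trig.
    rewrite big1// => i _; rewrite mxE; case: eqP => [->|_]; first exact: divff.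
    by rewrite eqxx.
  apply/is_trig_mxP => i j ij; rewrite mxE.
  have -> : (i == ord_max) = false.
    by apply/negP => /eqP im; move: ij; rewrite im ltnNge -ltnS ltn_ord.
  by case: eqP => // eij; move: ij; rewrite eij ltnn.
rewrite mul1r mulr1 big_ord_recr /= mxE eqxx; congr (_ * _).
rewrite (eq_bigr (fun=> c)); first by rewrite prodr_const card_ord.
by move=> i _; rewrite mxE ifF//; apply/negP => /eqP /(congr1 val) /= im;
  have := ltn_ord i; rewrite im ltnn.
Qed.

(** * Weighted geometric means: inequalities, continuity, second derivatives *)

(** Young's inequality for the conjugate exponents [b^-1] and [(1 - b)^-1], applied to [x]^ b[and]y
    [^ (1 - b)]. *)
Lemma powR_amgm (R : realType) (b x y : R) : 0 < b -> b < 1 -> 0 <= x -> 0 <= y ->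
  x `^ b * y `^ (1 - b) <= b * x + (1 - b) * y.
Proof.
move=> b0 b1 x0 y0; have b'0 : 0 < 1 - b by rewrite subr_gt0.
have := @conjugate_powR R (x `^ b) (y `^ (1 - b)) b^-1 (1 - b)^-1.
rewrite !invrK -!powRrM !divff ?gt_eqF// !powRr1// => /(_ (powR_ge0 _ _) (powR_ge0 _ _)).
rewrite !invr_gt0 => /(_ b0 b'0); rewrite [x * b]mulrC [y * _]mulrC; apply; lra.
Qed.

(** Together with homogeneity of degree one, this is concavity of the geometric mean. If neither sum
    vanishes, divide by the right-hand side and apply [powR_amgm] to the ratios [x / X] and [y / Y];
    the two upper bounds add up to [b + (1 - b) = 1]. *)
Lemma powR_geo_superadd (R : realType) (b x1 y1 x2 y2 : R) : 0 < b -> b < 1 ->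
  0 <= x1 -> 0 <= y1 -> 0 <= x2 -> 0 <= y2 ->
  x1 `^ b * y1 `^ (1 - b) + x2 `^ b * y2 `^ (1 - b)
  <= (x1 + x2) `^ b * (y1 + y2) `^ (1 - b).
Proof.
move=> b0 b1 x10 y10 x20 y20; have b'0 : 0 < 1 - b by rewrite subr_gt0.
have [X0|Xn0] := eqVneq (x1 + x2) 0.
  have -> : x1 = 0 by lra.
  have -> : x2 = 0 by lra.
  by rewrite addr0 !powR0 ?gt_eqF// !mul0r addr0.
have [Y0|Yn0] := eqVneq (y1 + y2) 0.
  have -> : y1 = 0 by lra.
  have -> : y2 = 0 by lra.
  by rewrite addr0 !powR0 ?gt_eqF// !mulr0 addr0.
have X0 : 0 < x1 + x2 by rewrite lt_neqAle eq_sym Xn0 addr_ge0.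
have Y0 : 0 < y1 + y2 by rewrite lt_neqAle eq_sym Yn0 addr_ge0.
set X := x1 + x2 in X0 Xn0 *; set Y := y1 + y2 in Y0 Yn0 *.
set G := X `^ b * Y `^ (1 - b).
have G0 : 0 <= G by rewrite mulr_ge0 ?powR_ge0.
have key x y : 0 <= x -> 0 <= y ->
    x `^ b * y `^ (1 - b) <= G * (b * (x / X) + (1 - b) * (y / Y)).
  move=> x0 y0; rewrite -{1}(divfK Xn0 x) -{1}(divfK Yn0 y).
  have xX : 0 <= x / X by rewrite divr_ge0// ltW.
  have yY : 0 <= y / Y by rewrite divr_ge0// ltW.
  rewrite (powRM _ xX (ltW X0)) (powRM _ yY (ltW Y0)).
  rewrite mulrACA -/G mulrC.
  by rewrite ler_wpM2l// powR_amgm.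
apply: (le_trans (lerD (key _ _ x10 y10) (key _ _ x20 y20))).
rewrite -mulrDr ler_piMr// le_eqVlt; apply/orP; left; apply/eqP.
by move: Xn0 Yn0; rewrite /X /Y => Xn0 Yn0; field; apply/andP; split.
Qed.

(* The truncation is needed since [powR] jumps to [1] at negative bases. *)
Lemma powR_max0_continuous (R : realType) (b : R) : 0 < b ->
  continuous (fun z : R => Num.max z 0 `^ b).
Proof.
move=> b0 x; have [x0|x0|->] := ltgtP x 0.
- apply: (@cvg_trans _ ((fun=> 0 : R) @ x)).
    apply: near_eq_cvg; near=> z.
    have z0 : z < 0 by near: z; exact: (lt_nbhsl x0).
    by rewrite max_r ?(ltW z0)// powR0// gt_eqF.
  rewrite max_r ?(ltW x0)// powR0 ?gt_eqF//; exact: (@cst_continuous R R 0 x).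
- apply: (@cvg_trans _ ((@powR R ^~ b) @ x)).
    apply: near_eq_cvg; near=> z.
    have z0 : 0 < z by near: z; exact: lt_nbhsr.
    by rewrite max_l ?(ltW z0).
  rewrite max_l ?(ltW x0)//; exact: gt0_powR_continuous.
- rewrite /continuous_at maxxx powR0 ?gt_eqF//; apply/cvgrPdist_lt => e e0.
  near=> z; rewrite sub0r normrN ger0_norm ?powR_ge0//.
  (* The radius is the number whose power [b] is [e]. *)
  have ze : `|z| < e `^ b^-1.
    by near: z; apply: (@nbhs0_lt R R); rewrite powR_gt0.
  have zm : Num.max z 0 < e `^ b^-1.
    by rewrite gt_max powR_gt0// andbT (le_lt_trans (ler_norm _)).
  have z0 : 0 <= Num.max z 0 by rewrite le_max lexx orbT.
  rewrite -[ltRHS]powRr1 ?ltW// -(@mulVf _ b) ?gt_eqF// powRrM.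
  by apply: gt0_ltr_powR => //; rewrite nnegrE ?powR_ge0.
Unshelve. all: by end_near. Qed.

(* Homogeneity of degree one in [(y, h)] makes the second term of rank one. *)
Lemma sderiv2_geo (R : realType) n (l : 'I_n) (e : sexpr R n) (b : R)
    (x : 'rV[R]_n) (i j : 'I_n) :
  0 < x ord0 l -> 0 < seval e x ->
  let y := x ord0 l in let h := seval e x in
  let G := y `^ b * h `^ (1 - b) in
  let w k := h * (l == k)%:R - y * seval (sderiv k e) x in
  seval (sderiv i (sderiv j (EAdd (EVar l) (EMul (ECst (-1))
    (EMul (EPow (EVar l) b) (EPow e (1 - b))))))) x =
  - ((1 - b) * G / h) * seval (sderiv i (sderiv j e)) x
  + b * (1 - b) * G / (y ^+ 2 * h ^+ 2) * w i * w j.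
Proof.
move=> y0 h0 /=.
(* Turning shifted exponents into quotients makes the identity rational in the remaining powers,
   within reach of [field]. *)
have pB (z a : R) : 0 < z -> z `^ (a - 1) = z `^ a / z.
  move=> z0; rewrite powRB; last by rewrite (gt_eqF z0) implybT.
  by rewrite powRr1// ltW.
rewrite !pB//.
by field; rewrite !gt_eqF.
Qed.

(** * The domain under the paraboloid and its symbolic description *)

Definition height {R : realType} {m} (x : 'rV[R]_m.+1) : R := x ord0 ord_max.

Definition cap {R : realType} {m} (x : 'rV[R]_m.+1) : R :=
  1 - \sum_(i < m.+1 | i != ord_max) x ord0 i ^+ 2.

Definition dome {R : realType} {m} : set 'rV[R]_m.+1 :=
  [set x | 0 < height x < cap x].

Definition dome_fun {R : realType} {m} (b : R) (x : 'rV[R]_m.+1) : R :=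
  height x - height x `^ b * cap x `^ (1 - b).

Definition cap_expr {R : realType} {m} : sexpr R m.+1 :=
  EAdd (ECst 1) (EMul (ECst (-1))
    (\big[EAdd/ECst 0]_(i < m.+1 | i != ord_max) EMul (EVar i) (EVar i))).

Lemma seval_big (R : realType) n (I : finType) (P : pred I)
    (F : I -> sexpr R n) x :
  seval (\big[EAdd/ECst 0]_(i | P i) F i) x = \sum_(i | P i) seval (F i) x.
Proof. exact: (big_morph (fun e => seval e x)). Qed.

Lemma sderiv_big (R : realType) n (I : finType) (P : pred I)
    (F : I -> sexpr R n) k :
  sderiv k (\big[EAdd/ECst 0]_(i | P i) F i) =
  \big[EAdd/ECst 0]_(i | P i) sderiv k (F i).
Proof. exact: (big_morph (sderiv k)). Qed.

Lemma seval_cap (R : realType) m (x : 'rV[R]_m.+1) : seval cap_expr x = cap x.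
Proof.
by rewrite /= seval_big mulN1r.
Qed.

Lemma sdefined_cap (R : realType) m (x : 'rV[R]_m.+1) : sdefined cap_expr x.
Proof. by do 2!split => //; elim/big_ind: _. Qed.

Lemma sderiv_cap_max (R : realType) m (x : 'rV[R]_m.+1) :
  seval (sderiv ord_max cap_expr) x = 0.
Proof.
rewrite /= sderiv_big seval_big big1 => [|i im /=]; first by rewrite !mulr0 !addr0.
by rewrite (negbTE im) mulr0 addr0.
Qed.

Lemma sderiv2_cap (R : realType) m (x : 'rV[R]_m.+1) i j :
  seval (sderiv i (sderiv j cap_expr)) x =
  if (i == j) && (i != ord_max) then - 2 else 0.
Proof.
rewrite /= !mul0r !addr0 !add0r mulr0 addr0 !sderiv_big seval_big /=.
under eq_bigr do rewrite !(mulr0, addr0, add0r).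
rewrite mulr0 addr0.
have [->|ij] /= := eqVneq i j; last first.
  rewrite big1 ?mulr0// => l lm; have [lj|_] := eqVneq l j; last by rewrite !mul0r !addr0.
  by rewrite lj eq_sym (negbTE ij) !mulr0 !addr0.
have [->|jm] /= := eqVneq j ord_max.
  by rewrite big1 ?mulr0// => l lm; rewrite (negbTE lm) !mul0r !addr0.
rewrite (bigD1 j)//= big1 => [|l /andP[_ lj]]; last by rewrite (negbTE lj) !mul0r !addr0.
by rewrite eqxx mulr1n; ring.
Qed.

(** * Geometry and topology of the domain *)

Lemma height_continuous (R : realType) m : continuous (@height R m).
Proof. exact: coord_continuous. Qed.

Lemma cap_continuous (R : realType) m : continuous (@cap R m).
Proof.
have -> : @cap R m = seval cap_expr by apply/funext => x; rewrite seval_cap.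
move=> x; apply: differentiable_continuous.
by have [] := seval_differentiable _ _ _ _ (sdefined_cap _ _ x).
Qed.

Lemma heightD (R : realType) m (x y : 'rV[R]_m.+1) (s t : R) :
  height (s *: x + t *: y) = s * height x + t * height y.
Proof. by rewrite /height !mxE. Qed.

Lemma cap_concave (R : realType) m (x y : 'rV[R]_m.+1) (t : R) :
  0 <= t -> t <= 1 ->
  (1 - t) * cap x + t * cap y <= cap ((1 - t) *: x + t *: y).
Proof.
move=> t0 t1; rewrite /cap.
suff : \sum_(i < m.+1 | i != ord_max) ((1 - t) *: x + t *: y) ord0 i ^+ 2 <=
  (1 - t) * (\sum_(i < m.+1 | i != ord_max) x ord0 i ^+ 2)
  + t * (\sum_(i < m.+1 | i != ord_max) y ord0 i ^+ 2) by lra.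
rewrite !mulr_sumr -big_split/=; apply: ler_sum => i _; rewrite !mxE.
rewrite -subr_ge0 (_ : _ - _ = t * (1 - t) * (x ord0 i - y ord0 i) ^+ 2); last by ring.
by rewrite mulr_ge0 ?sqr_ge0// mulr_ge0// subr_ge0.
Qed.

Lemma cap_le (R : realType) m (x : 'rV[R]_m.+1) (i : 'I_m.+1) :
  i != ord_max -> cap x <= 1 - x ord0 i ^+ 2.
Proof.
move=> im; rewrite /cap lerD2l lerN2 (bigD1 i)//= lerDl.
by apply: sumr_ge0 => j _; exact: sqr_ge0.
Qed.

Lemma cap_le1 (R : realType) m (x : 'rV[R]_m.+1) : cap x <= 1.
Proof. by rewrite gerBl; apply: sumr_ge0 => j _; exact: sqr_ge0. Qed.

Lemma dome_open (R : realType) m : open (@dome R m).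
Proof.
have -> : @dome R m = (height @^-1` [set t | 0 < t])
    `&` ((fun x => cap x - height x) @^-1` [set t | 0 < t]).
  apply/seteqP; split=> x /=; first by move=> /andP[-> h]; rewrite subr_gt0.
  by rewrite subr_gt0 => -[h1 h2]; apply/andP.
apply: openI; (apply: open_comp; [move=> x _|exact: open_gt]).
  exact: height_continuous.
by apply: continuousB; [exact: cap_continuous|exact: height_continuous].
Qed.

Lemma dome_convex (R : realType) m : convex_set_Rn (@dome R m).
Proof.
move=> x y t /andP[hx cx] /andP[hy cy] t0 t1; apply/andP; rewrite heightD; split.
  by nra.
apply: lt_le_trans (cap_concave _ _ x y t t0 t1).
(* Strictness is taken from the [y] term, whose weight [t] must be positive. *)
have [->|tn0] := eqVneq t 0; first by rewrite subr0 !mul1r !mul0r !addr0.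
apply: ler_ltD; first by rewrite ler_wpM2l ?subr_ge0// ltW.
by rewrite ltr_pM2l// lt_neqAle eq_sym tn0.
Qed.

(** The set is the union of its segments from a fixed point [a], and connected sets sharing a point
    have a connected union. *)
Lemma convex_set_connected (R : realType) n (A : set 'rV[R]_n) :
  convex_set_Rn A -> connected A.
Proof.
move=> cA; have [->|/set0P[a Aa]] := eqVneq A set0; first exact: connected0.
pose seg y : set 'rV[R]_n := (fun t : R => (1 - t) *: a + t *: y) @` `[0, 1]%classic.
have -> : A = \bigcup_(y in A) seg y.
  apply/seteqP; split=> [y Ay|z [y Ay [t]]].
    exists y => //; exists 1; first by rewrite /= in_itv/= lexx ler01.
    by rewrite subrr scale0r add0r scale1r.
  by rewrite /= in_itv/= => /andP[t0 t1] <-; exact: cA.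
apply: bigcup_connected.
  exists a => y _; exists 0; first by rewrite /= in_itv/= lexx ler01.
  by rewrite subr0 scale1r scale0r addr0.
move=> y _; apply: connected_continuous_connected; first exact: segment_connected.
apply: continuous_subspaceT => t; apply: cvgD; apply: cvgZr_tmp.
  by apply: cvgB; [exact: cvg_cst|exact: cvg_id].
exact: cvg_id.
Qed.

Lemma dome_bounded (R : realType) m : bounded_set (@dome R m).
Proof.
exists 1; split; first exact: num_real.
move=> M M1 x /andP[hx cx]; rewrite /= (le_trans _ (ltW M1))//.
(* The norm is the largest absolute value of an entry. The last entry lies below [cap x <= 1]; any
   other has square at most [1 - cap x < 1]. *)
rewrite /Num.norm/= mx_normrE; apply/bigmax_leP; split => // -[i j] _ /=.
rewrite ord1; have [->|jm] := eqVneq j ord_max.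
  rewrite ler_norml; move: hx cx (cap_le1 _ _ x); rewrite /height; lra.
have := cap_le _ _ x j jm; move: hx cx; set z := x _ _.
by rewrite ler_norml => *; apply/andP; split; nra.
Qed.

Lemma axisE (R : realType) m (t : R) :
  height (t *: e_vec R (@ord_max m)) = t /\ cap (t *: e_vec R (@ord_max m)) = 1.
Proof.
split; first by rewrite /height !mxE !eqxx mulr1.
rewrite /cap big1 ?subr0// => i im; rewrite !mxE (negbTE im) andbF mulr0.
by rewrite expr0n.
Qed.

Lemma dome_axis (R : realType) m (t : R) : 0 < t < 1 ->
  dome (t *: e_vec R (@ord_max m)).
Proof. by rewrite /dome/=; have [-> ->] := axisE R m t. Qed.

(** The origin, where the Hoelder bound will fail, is a limit of points of [dome] on the vertical
    axis. *)
Lemma closure_dome0 (R : realType) m : closure dome (0 : 'rV[R]_m.+1).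
Proof.
move=> B B0.
have cv : (t *: e_vec R (@ord_max m) : 'rV[R]_m.+1) @[t --> (0 : R)^'+] --> (0 : 'rV[R]_m.+1).
  apply: cvg_at_right_filter.
  rewrite -[X in _ --> X](scale0r (e_vec R (@ord_max m))).
  by apply: cvgZr_tmp; exact: cvg_id.
have /filter_ex[t [Bt /andP[t0 t1]]] : \forall t \near (0 : R)^'+,
    B (t *: e_vec R (@ord_max m)) /\ 0 < t < 1.
  near=> t; split; first by near: t; exact: cv.
  apply/andP; split; first by near: t; exact: nbhs_right_gt.
  by near: t; exact: nbhs_right_lt.
by exists (t *: e_vec R ord_max); split=> //; apply: dome_axis; rewrite t0 t1.
Unshelve. all: by end_near. Qed.

(** The weak inequalities cut out a closed set containing [dome]. Convexity, continuity and boundary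
    values of [dome_fun] all rest on them. *)
Lemma closure_dome_sub (R : realType) m (x : 'rV[R]_m.+1) :
  closure dome x -> 0 <= height x <= cap x.
Proof.
pose A : set 'rV[R]_m.+1 := (height @^-1` [set t | 0 <= t])
    `&` ((fun x => cap x - height x) @^-1` [set t | 0 <= t]).
have cA : closed A.
  apply: closedI; (apply: preimage_closed; [move=> y _|exact: closed_ge]).
    exact: height_continuous.
  by apply: continuousB; [exact: cap_continuous|exact: height_continuous].
have dA : dome `<=` A.
  by move=> y /andP[h1 h2]; split; rewrite /= ?subr_ge0 ltW.
move=> /(closureS dA)/cA[h1].
by rewrite /= subr_ge0 => h2; apply/andP.
Qed.

(** * Convexity, continuity and boundary values of the function *)

(** Homogeneity moves the weights [1 - t] and [t] inside the powers, [powR_geo_superadd] adds the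
    two terms, and monotonicity in the second argument absorbs the concavity of [cap]. *)
Lemma dome_fun_convex (R : realType) m (b : R) : 0 < b -> b < 1 ->
  convex_fun_on (closure (@dome R m)) (dome_fun b).
Proof.
move=> b0 b1 x y t /closure_dome_sub/andP[hx cx] /closure_dome_sub/andP[hy cy] t0 t1.
have b'0 : 0 < 1 - b by rewrite subr_gt0.
have t'0 : 0 <= 1 - t by rewrite subr_ge0.
have cx0 := le_trans hx cx; have cy0 := le_trans hy cy.
rewrite /dome_fun heightD.
suff : (1 - t) * (height x `^ b * cap x `^ (1 - b)) +
    t * (height y `^ b * cap y `^ (1 - b)) <=
    ((1 - t) * height x + t * height y) `^ b *
    cap ((1 - t) *: x + t *: y) `^ (1 - b) by lra.
have scal (s u v : R) : 0 <= s -> 0 <= u -> 0 <= v ->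
    s * (u `^ b * v `^ (1 - b)) = (s * u) `^ b * (s * v) `^ (1 - b).
  move=> s0 u0 v0; rewrite !powRM// mulrACA -powRD; last by rewrite subrKC oner_eq0.
  by rewrite subrKC powRr1.
rewrite !scal//.
apply: (le_trans (powR_geo_superadd _ b _ _ _ _ b0 b1 _ _ _ _)); rewrite ?mulr_ge0//.
rewrite ler_wpM2l ?powR_ge0//; apply: ge0_ler_powR; first exact: ltW.
- by rewrite nnegrE addr_ge0// mulr_ge0.
- by rewrite nnegrE (le_trans _ (cap_concave _ _ x y t t0 t1))// addr_ge0// mulr_ge0.
- exact: cap_concave.
Qed.

(** On the closure both bases are nonnegative, so the function agrees there with the truncated [w],
    which is continuous on the whole space. *)
Lemma dome_fun_continuous (R : realType) m (b : R) : 0 < b -> b < 1 ->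
  {within closure (@dome R m), continuous (dome_fun b)}.
Proof.
move=> b0 b1; have b'0 : 0 < 1 - b by rewrite subr_gt0.
pose w (x : 'rV[R]_m.+1) := height x -
  Num.max (height x) 0 `^ b * Num.max (cap x) 0 `^ (1 - b).
apply: (@subspace_eq_continuous _ _ _ w).
  move=> x; rewrite inE => /closure_dome_sub/andP[h c].
  by rewrite /from_subspace /w max_l// max_l// (le_trans h).
apply: continuous_subspaceT => x; apply: continuousB; first exact: height_continuous.
apply: continuousM.
  apply: (@continuous_comp _ _ _ height (fun z : R => Num.max z 0 `^ b)).
    exact: height_continuous.
  exact: powR_max0_continuous.
apply: (@continuous_comp _ _ _ cap (fun z : R => Num.max z 0 `^ (1 - b))).
  exact: cap_continuous.
exact: powR_max0_continuous.
Qed.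

Lemma dome_fun_boundary (R : realType) m (b : R) (x : 'rV[R]_m.+1) :
  0 < b -> b < 1 -> closure dome x -> ~ dome x -> dome_fun b x = 0.
Proof.
move=> b0 b1 /closure_dome_sub/andP[h c] nd; rewrite /dome_fun.
have [->|hn0] := eqVneq (height x) 0; first by rewrite powR0 ?gt_eqF// mul0r subr0.
have h0 : 0 < height x by rewrite lt_neqAle eq_sym hn0.
have -> : cap x = height x.
  apply/eqP; rewrite eq_le c andbT leNgt; apply/negP => hc.
  by apply: nd; apply/andP.
by rewrite -powRD ?subrKC ?oner_eq0// powRr1// subrr.
Qed.

(** * Smoothness and the Hessian determinant *)

Definition dome_expr {R : realType} {m} (b : R) : sexpr R m.+1 :=
  EAdd (EVar ord_max) (EMul (ECst (-1))
    (EMul (EPow (EVar ord_max) b) (EPow cap_expr (1 - b)))).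

Lemma dome_funE (R : realType) m (b : R) (x : 'rV[R]_m.+1) :
  dome_fun b x = seval (dome_expr b) x.
Proof.
rewrite /dome_expr -[RHS]/(height x + -1 * (height x `^ b * seval cap_expr x `^ (1 - b))).
by rewrite seval_cap mulN1r.
Qed.

Lemma sdefined_dome (R : realType) m (b : R) (x : 'rV[R]_m.+1) :
  dome x -> sdefined (dome_expr b) x.
Proof.
move=> /andP[h c]; split=> //; split=> //; split; first by split.
split; last exact: sdefined_cap.
by rewrite seval_cap (lt_trans h).
Qed.

Lemma dome_fun_smooth (R : realType) m (b : R) :
  smooth_on (@dome R m) (dome_fun b).
Proof.
apply: seval_smooth; first exact: dome_open.
  by move=> x; exact: (@sdefined_dome R m b).
by move=> x _; exact: dome_funE.
Qed.

(** As [cap] does not depend on the last coordinate, [w ord_max] equals [cap x] and [det_diag_rank1]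
    applies. With [p = m.+1%:R * b - 1] the exponents read [p - 1] and [- p], so that integrating
    over the height cancels the power of [cap]. *)
Lemma det_hessian_dome (R : realType) m (b : R) (x : 'rV[R]_m.+1) : dome x ->
  \det (hessian (dome_fun b) x) =
  (2 * (1 - b)) ^+ m * (b * (1 - b)) *
  (height x `^ (m.+1%:R * b - 1 - 1) * cap x `^ (- (m.+1%:R * b - 1))).
Proof.
move=> dx; have /andP[h0 hc] := dx; have c0 := lt_trans h0 hc.
rewrite (seval_hessian R m.+1 dome (dome_expr b) (dome_fun b) (dome_open R m)
  (fun y => sdefined_dome R m b y) (fun y _ => dome_funE R m b y) x dx).
set G := height x `^ b * cap x `^ (1 - b).
(* [w] is [cap x ^+ 2] times the gradient of the ratio of [height] to [cap]. *)
pose w (k : 'I_m.+1) := cap x * (ord_max == k)%:R - height x * seval (sderiv k cap_expr) x.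
have -> : \matrix_(i, j) seval (sderiv i (sderiv j (dome_expr b))) x =
    \matrix_(i, j) ((if (i == j) && (i != ord_max) then 2 * (1 - b) * G / cap x else 0)
      + (b * (1 - b) * G / (height x ^+ 2 * cap x ^+ 2)) * w i * w j).
  apply/matrixP => i j; rewrite [LHS]mxE [RHS]mxE sderiv2_geo//; last by rewrite seval_cap.
  rewrite sderiv2_cap seval_cap -/(height x) -/G; congr (_ + _).
  by case: ifP => _; [ring|rewrite mulr0].
have wm : w ord_max = cap x by rewrite /w sderiv_cap_max eqxx mulr0 subr0 mulr1.
rewrite det_diag_rank1 wm ?gt_eqF//.
have -> : 2 * (1 - b) * G / cap x = 2 * (1 - b) * (G / cap x) by ring.
rewrite exprMn.
have -> : G / cap x = height x `^ b * cap x `^ (- b).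
  rewrite /G -mulrA -[in _^-1](powRr1 (ltW c0)) -powRN -powRD; last first.
    by rewrite (gt_eqF c0) implybT.
  by congr (_ * _ `^ _); ring.
have pX (z a : R) : (z `^ a) ^+ m = z `^ (a * m%:R).
  by rewrite powRrM powR_mulrn ?powR_ge0.
rewrite [(height x `^ b * _) ^+ m]exprMn !pX.
have pB (z a c : R) : 0 < z -> z `^ (a - c) = z `^ a / z `^ c.
  by move=> z0; rewrite powRB// (gt_eqF z0) implybT.
have pD (z a c : R) : 0 < z -> z `^ (a + c) = z `^ a * z `^ c.
  by move=> z0; rewrite powRD// (gt_eqF z0) implybT.
(* In both exponents the summand with [m] comes from the [m] equal diagonal entries, the rest from
   the rank-one factor [G / height x ^+ 2]. *)
have -> : m.+1%:R * b - 1 - 1 = b * m%:R + (b - 1 - 1) :> R.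
  by rewrite -natr1; ring.
have -> : - (m.+1%:R * b - 1) = - b * m%:R + (1 - b) :> R.
  by rewrite -natr1; ring.
rewrite (pD _ (b * m%:R))// (pD _ (- b * m%:R))// pB// [height x `^ (b - 1)]pB//.
rewrite !powRr1 ?ltW// /G.
by field; rewrite !gt_eqF.
Qed.

(** * Integrability of the determinant *)

Lemma height_set_last (R : realType) m (x : 'rV[R]_m.+1) (t : R) :
  height (set_last x t) = t.
Proof. by rewrite /height mxE eqxx. Qed.

Lemma cap_set_last (R : realType) m (x : 'rV[R]_m.+1) (t : R) :
  cap (set_last x t) = cap x.
Proof.
by rewrite /cap; congr (_ - _); apply: eq_bigr => i im; rewrite mxE (negbTE im).
Qed.

(** On a slice with [cap x > 0] the integral over the height is at most [C * cap x]^ (- p) * (cap x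
    [^ p / p) = C / p], whatever the slice; other slices miss [dome]. The remaining [m] coordinates
    range over [-1, 1]. *)
Lemma dome_fun_L1 (R : realType) m (b : R) :
  0 < b -> b < 1 -> 1 < m.+1%:R * b ->
  L1_on (@dome R m) (fun x => \det (hessian (dome_fun b) x)).
Proof.
move=> b0 b1 mb; rewrite /L1_on.
set f := (X in iter_integral X).
pose p := m.+1%:R * b - 1; have p0 : 0 < p by rewrite subr_gt0.
pose C := (2 * (1 - b)) ^+ m * (b * (1 - b)).
have b'0 : 0 <= 1 - b by rewrite subr_ge0 ltW.
have C0 : 0 <= C by rewrite mulr_ge0 ?exprn_ge0 ?mulr_ge0// ltW.
suff : (iter_integral f <= ((C / p) * 2 ^+ m)%:E)%E.
  by move=> h; apply: (le_lt_trans h); exact: ltry.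
apply: iter_integral_le.
- by move=> x; rewrite /f; case: ifP => // _; rewrite lee_fin.
- move=> x i im xi; rewrite /f ifF//; apply/negP => /asboolP/andP[h c].
  have := cap_le _ _ x i im; have : 1 < x ord0 i ^+ 2.
    by rewrite -[X in _ < X]real_normK ?num_real// expr_gt1// ltW.
  by lra.
- move=> x; have [c0|c0] := leP (cap x) 0.
    rewrite integral0_eq ?lee_fin ?divr_ge0 ?(ltW p0)// => t _.
    rewrite /f ifF//; apply/negP => /asboolP/andP.
    by rewrite height_set_last cap_set_last => -[h c]; lra.
  have Dp0 : 0 <= C * cap x `^ (- p) by rewrite mulr_ge0 ?powR_ge0.
  apply: (@le_trans _ _ (\int[lebesgue_measure]_t
     ((fun t : R => ((C * cap x `^ (- p)) * t `^ (p - 1))%:E) \_ `]0%R, cap x]) t))%E.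
    apply: ge0_le_integralT => t; rewrite /f.
      by case: ifP => // _; rewrite lee_fin.
    case: ifPn => [/asboolP dt|_]; last first.
      by apply: erestrict_ge0 => s _; rewrite lee_fin mulr_ge0 ?powR_ge0.
    have := dt; rewrite /dome/= height_set_last cap_set_last => /andP[t0 tc].
    rewrite patchE ifT; last by rewrite inE/= in_itv/= t0 ltW.
    rewrite lee_fin det_hessian_dome// height_set_last cap_set_last -/p -/C.
    rewrite ger0_norm; last by rewrite mulr_ge0// mulr_ge0 ?powR_ge0.
    by rewrite [X in C * X]mulrC mulrA.
  rewrite -integral_mkcond.
  under eq_integral do rewrite EFinM.
  have mt : measurable_fun (`]0%R, cap x]%classic : set R) (EFin \o (@powR R ^~ (p - 1))).
    apply: (@measurable_funS _ _ _ _ setT) => //.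
    by apply/measurable_EFinP; exact: measurable_powR.
  rewrite ge0_integralZl//=; last by move=> t _; rewrite lee_fin powR_ge0.
  apply: (@le_trans _ _ ((C * cap x `^ (- p))%:E * (cap x `^ p / p)%:E)%E).
    by rewrite lee_wpmul2l// integral_powR_le.
  rewrite -EFinM lee_fin powRN -mulrA [_^-1 * _]mulrA mulVf ?mul1r//.
  by rewrite gt_eqF// powR_gt0.
Qed.

(** * Failure of the Hoelder condition *)

Lemma eucl_norm_axis (R : realType) m (t : R) : 0 <= t ->
  eucl_norm (t *: e_vec R (@ord_max m)) = t.
Proof.
move=> t0; rewrite /eucl_norm (bigD1 ord_max)//= big1 => [|i im].
  by rewrite !mxE !eqxx mulr1 addr0 sqrtr_sqr ger0_norm.
by rewrite !mxE (negbTE im) andbF mulr0 expr0n.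
Qed.

Lemma dome_fun_not_holder (R : realType) m (a b : R) : 0 < b -> b < a -> a < 1 ->
  ~ holder_on a (closure (@dome R m)) (dome_fun b).
Proof.
(* The constant [C] may have any sign; [C'] is positive, so [(2 * C')^-1] is a usable threshold. *)
move=> b0 ba a1 [C hC]; pose C' := Num.max C 1.
have C'0 : 0 < C' by rewrite lt_max ltr01 orbT.
have b1 : b < 1 by lra.
have /filter_ex[t [/andP[t0 t1] t2 t3]] : \forall t \near (0 : R)^'+,
    [/\ 0 < t < 1, t `^ (1 - b) < 2^-1 & t `^ (a - b) < (2 * C')^-1].
  near=> t; split.
  - apply/andP; split; first by near: t; exact: nbhs_right_gt.
    by near: t; exact: nbhs_right_lt.
  - near: t; apply: (cvgr_lt 0); last by rewrite invr_gt0.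
    by apply: powR_cvg0; rewrite subr_gt0.
  - near: t; apply: (cvgr_lt 0); last by rewrite invr_gt0 mulr_gt0.
    by apply: powR_cvg0; rewrite subr_gt0.
have ct : closure dome (t *: e_vec R (@ord_max m)).
  by apply: subset_closure; apply: dome_axis; rewrite t0 t1.
have := hC _ _ ct (closure_dome0 R m); rewrite subr0 eucl_norm_axis ?(ltW t0)//.
have -> : dome_fun b (0 : 'rV[R]_m.+1) = 0.
  have [h0 _] := axisE R m 0; rewrite scale0r in h0.
  by rewrite /dome_fun h0 powR0 ?gt_eqF// mul0r subr0.
rewrite subr0 /dome_fun; have [-> ->] := axisE R m t; rewrite powR1 mulr1.
have tE : t = t `^ b * t `^ (1 - b).
  by rewrite -powRD ?subrKC ?oner_eq0// powRr1// ltW.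
have taE : t `^ a = t `^ b * t `^ (a - b).
  by rewrite -powRD ?subrKC// (gt_eqF t0) implybT.
have tb0 : 0 < t `^ b by rewrite powR_gt0.
rewrite distrC ger0_norm; last first.
  by rewrite {2}tE subr_ge0 ler_piMr ?(ltW tb0)//; lra.
rewrite {2}tE taE => hle.
have {hle} : 1 - t `^ (1 - b) <= C * t `^ (a - b).
  rewrite -(ler_pM2l tb0) mulrBr mulr1; apply: (le_trans hle).
  by rewrite mulrCA.
have : C * t `^ (a - b) <= C' * t `^ (a - b).
  by rewrite ler_wpM2r ?powR_ge0// le_max lexx.
have : C' * t `^ (a - b) < 2^-1.
  by rewrite -ltr_pdivlMl// -invfM [C' * _]mulrC.
by lra.
Unshelve. all: by end_near. Qed.

Theorem theorem1p2 (R : realType) (n : nat) (hn : (2 <= n)%N) (alpha : R)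
    (ha1 : n%:R^-1 < alpha) (ha2 : alpha < 1) :
  exists (Omega : set 'rV[R]_n) (v : 'rV[R]_n -> R),
    [/\ open Omega, connected Omega, Omega !=set0, bounded_set Omega &
        convex_set_Rn Omega] /\
    [/\ convex_fun_on (closure Omega) v,
        {within closure Omega, continuous v},
        smooth_on Omega v,
        (forall x, closure Omega x -> ~ Omega x -> v x = 0) &
        L1_on Omega (fun x => \det (hessian v x))] /\
    ~ holder_on alpha (closure Omega) v.
Proof.
case: n hn ha1 => // m _ ha1.
have [b nb ba] : exists2 b, m.+1%:R^-1 < b & b < alpha.
  by exists ((m.+1%:R^-1 + alpha) / 2); rewrite midf_lt.
have b0 : 0 < b by apply: lt_trans nb; rewrite invr_gt0.
have b1 := lt_trans ba ha2.
exists dome, (dome_fun b); split; [split|split; [split|]].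
- exact: dome_open.
- exact/convex_set_connected/dome_convex.
- by exists (2^-1 *: e_vec R ord_max); apply: dome_axis; apply/andP; split; lra.
- exact: dome_bounded.
- exact: dome_convex.
- exact: dome_fun_convex.
- exact: dome_fun_continuous.
- exact: dome_fun_smooth.
- by move=> x; exact: dome_fun_boundary.
- by apply: dome_fun_L1 => //; rewrite -ltr_pdivrMl// mulr1.
- exact: dome_fun_not_holder.
Qed.
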